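(* Let $L>M$ be integers, let $\alpha\in\mathbb{C}$, and let $\tau:\mathbb{Z}\to\mathbb{C}\setminus\{0\}$. Set $$v_m=\frac{\tau_m\,\tau_{m+L+M}}{\tau_{m+M}\,\tau_{m+L}}\qquad(m\in\mathbb{Z}).$$ Suppose that $v$ satisfies, for all $m\in\mathbb{Z}$, $$v_{m+L+M}-v_m=\alpha\left(\frac{1}{v_{m+L}}-\frac{1}{v_{m+M}}\right).\quad( * )$$ Then $\tau$ satisfies both of the following bilinear equations for all $m\in\mathbb{Z}$, for some sequences $(\beta_m)$ and $(\beta'_m)$ with the stated periodicity: $$\tau_{m+2L+M}\,\tau_m=\beta_m\,\tau_{m+L+M}\,\tau_{m+L}-\alpha\,\tau_{m+2L}\,\tau_{m+M},\qquad \beta_{m+M}=\beta_m,\quad(1)$$ $$\tau_{m+2M+L}\,\tau_m=\beta'_m\,\tau_{m+L+M}\,\tau_{m+M}+\alpha\,\tau_{m+2M}\,\tau_{m+L},\qquad \beta'_{m+L}=\beta'_m.\quad(2)$$ Conversely, if $\tau$ is a solution of either (1) (for some $M$-periodic sequence $\beta_m$) or (2) (for some $L$-periodic sequence $\beta'_m$), then $v$ satisfies $( * )$.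
   Context: All sequences are complex-valued and indexed by $\mathbb{Z}$. *)

(* Defs.v *)
From Stdlib Require Import Reals ZArith.
From Coquelicot Require Import Coquelicot.

Local Open Scope C_scope.

Definition periodic (p : Z) (b : Z -> C) : Prop :=
  forall m : Z, b (m + p)%Z = b m.

Definition v_of (L M : Z) (tau : Z -> C) (m : Z) : C :=
  (tau m * tau (m + L + M)%Z) / (tau (m + M)%Z * tau (m + L)%Z).

Definition v_equation (L M : Z) (alpha : C) (v : Z -> C) : Prop :=
  forall m : Z,
    v (m + L + M)%Z - v m = alpha * (RtoC 1 / v (m + L)%Z - RtoC 1 / v (m + M)%Z).

Definition bilinear1 (L M : Z) (alpha : C) (beta tau : Z -> C) : Prop :=
  forall m : Z,
    tau (m + 2 * L + M)%Z * tau m =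
      beta m * tau (m + L + M)%Z * tau (m + L)%Z
      - alpha * tau (m + 2 * L)%Z * tau (m + M)%Z.

Definition bilinear2 (L M : Z) (alpha : C) (beta' tau : Z -> C) : Prop :=
  forall m : Z,
    tau (m + 2 * M + L)%Z * tau m =
      beta' m * tau (m + L + M)%Z * tau (m + M)%Z
      + alpha * tau (m + 2 * M)%Z * tau (m + L)%Z.

(* Main.v *)
(** Solve (1) for [beta m]. Up to nonvanishing factors, [beta (m + M) - beta m]
    is then the defect at [m] of the equation for [v], so [beta] is [M]-periodic
    iff that equation holds. Equation (2) is (1) under the substitution
    [(L, M, alpha) -> (M, L, - alpha)], which leaves the equation for [v]
    invariant. *)
Require Import Defs.
From Stdlib Require Import Reals ZArith.
From Coquelicot Require Import Coquelicot.

Local Open Scope C_scope.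

Lemma Cmult_cancel_0 (x y : C) : x <> RtoC 0 -> x * y = RtoC 0 -> y = RtoC 0.
Proof.
  intros Hx Hxy.
  replace y with (x * y / x) by (field; exact Hx).
  rewrite Hxy; field; exact Hx.
Qed.

Definition beta_of (L M : Z) (alpha : C) (tau : Z -> C) (m : Z) : C :=
  (tau (m + 2 * L + M)%Z * tau m + alpha * tau (m + 2 * L)%Z * tau (m + M)%Z)
  / (tau (m + L + M)%Z * tau (m + L)%Z).

(** At each [m] the relation is linear in [beta m] with nonzero coefficient, so [tau] leaves a
    single candidate for [beta], and only its periodicity remains in question. *)
Lemma bilinear1_beta_of (L M : Z) (alpha : C) (beta tau : Z -> C)
    (htau : forall m : Z, tau m <> RtoC 0) :
  bilinear1 L M alpha beta tau <-> forall m : Z, beta m = beta_of L M alpha tau m.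
Proof.
  split; intros H m; specialize (H m).
  - unfold beta_of; rewrite H.
    field; split; apply htau.
  - rewrite H; unfold beta_of.
    field; split; apply htau.
Qed.

(** Dividing by the prefactor on the right matches terms one by one: [beta_of] at [m + M] gives
    [v (m + L + M) + alpha / v (m + M)], and at [m] it gives [v m + alpha / v (m + L)]. *)
Lemma beta_of_shift (L M : Z) (alpha : C) (tau : Z -> C)
    (htau : forall m : Z, tau m <> RtoC 0) (m : Z) (v := v_of L M tau) :
  tau (m + L + M)%Z * tau (m + L + M)%Z
    * (beta_of L M alpha tau (m + M)%Z - beta_of L M alpha tau m)
  = tau (m + 2 * L + M)%Z * tau (m + M)%Z
    * (v (m + L + M)%Z - v m
       - alpha * (RtoC 1 / v (m + L)%Z - RtoC 1 / v (m + M)%Z)).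
Proof.
  unfold v, beta_of, v_of.
  (* Each index is brought to a normal form [m + a * L + b * M], so that [field] sees equal values
     of [tau] as one atom. *)
  replace (m + M + 2 * L + M)%Z with (m + 2 * L + 2 * M)%Z by ring.
  replace (m + M + 2 * L)%Z with (m + 2 * L + M)%Z by ring.
  replace (m + M + M)%Z with (m + 2 * M)%Z by ring.
  replace (m + M + L + M)%Z with (m + L + 2 * M)%Z by ring.
  replace (m + M + L)%Z with (m + L + M)%Z by ring.
  replace (m + L + M + L + M)%Z with (m + 2 * L + 2 * M)%Z by ring.
  replace (m + L + M + M)%Z with (m + L + 2 * M)%Z by ring.
  replace (m + L + M + L)%Z with (m + 2 * L + M)%Z by ring.
  replace (m + L + L + M)%Z with (m + 2 * L + M)%Z by ring.
  replace (m + L + L)%Z with (m + 2 * L)%Z by ring.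
  field; repeat split; apply htau.
Qed.

Lemma v_equation_iff_bilinear1 (L M : Z) (alpha : C) (tau : Z -> C)
    (htau : forall m : Z, tau m <> RtoC 0) :
  v_equation L M alpha (v_of L M tau) <->
  exists beta : Z -> C, periodic M beta /\ bilinear1 L M alpha beta tau.
Proof.
  split.
  - intros H; exists (beta_of L M alpha tau); split.
    + intros m; apply Ceq_minus.
      apply (Cmult_cancel_0 (tau (m + L + M)%Z * tau (m + L + M)%Z)).
      * now apply Cmult_neq_0.
      * rewrite (beta_of_shift _ _ _ _ htau), H; ring.
    + now apply bilinear1_beta_of.
  - intros [beta [Hper Hbil]] m.
    rewrite bilinear1_beta_of in Hbil by assumption.
    apply Ceq_minus.
    apply (Cmult_cancel_0 (tau (m + 2 * L + M)%Z * tau (m + M)%Z)).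
    + now apply Cmult_neq_0.
    (* The defect of the equation for [v] turns into a multiple of [beta (m + M) - beta m], which
       periodicity kills. *)
    + rewrite <- (beta_of_shift _ _ _ _ htau), <- !Hbil, Hper; ring.
Qed.

(** [v] is symmetric in [L] and [M], while the difference of reciprocals changes sign, which
    [- alpha] absorbs. *)
Lemma v_equation_swap (L M : Z) (alpha : C) (tau : Z -> C) :
  v_equation L M alpha (v_of L M tau) <->
  v_equation M L (- alpha) (v_of M L tau).
Proof.
  assert (Hv : forall m : Z, v_of M L tau m = v_of L M tau m).
  { intros m; unfold v_of.
    replace (m + M + L)%Z with (m + L + M)%Z by ring.
    now rewrite (Cmult_comm (tau (m + L)%Z)). }
  split; intros H m; specialize (H m); rewrite ?Hv in *;
    replace (m + M + L)%Z with (m + L + M)%Z in * by ring;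
    rewrite H; ring.
Qed.

Lemma bilinear2_swap (L M : Z) (alpha : C) (beta tau : Z -> C) :
  bilinear2 L M alpha beta tau <-> bilinear1 M L (- alpha) beta tau.
Proof.
  split; intros H m; specialize (H m);
    replace (m + M + L)%Z with (m + L + M)%Z in * by ring;
    rewrite H; ring.
Qed.

Lemma v_equation_iff_bilinear2 (L M : Z) (alpha : C) (tau : Z -> C)
    (htau : forall m : Z, tau m <> RtoC 0) :
  v_equation L M alpha (v_of L M tau) <->
  exists beta : Z -> C, periodic L beta /\ bilinear2 L M alpha beta tau.
Proof.
  (* After the swap, the period [M] in the criterion for (1) becomes [L]. *)
  rewrite v_equation_swap, v_equation_iff_bilinear1 by assumption.
  now setoid_rewrite bilinear2_swap.
Qed.

Theorem proposition4p2 (L M : Z) (hLM : (M < L)%Z) (alpha : C)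
    (tau : Z -> C) (htau : forall m : Z, tau m <> RtoC 0) :
  (v_equation L M alpha (v_of L M tau) ->
     (exists beta : Z -> C, periodic M beta /\ bilinear1 L M alpha beta tau) /\
     (exists beta' : Z -> C, periodic L beta' /\ bilinear2 L M alpha beta' tau)) /\
  ((exists beta : Z -> C, periodic M beta /\ bilinear1 L M alpha beta tau) \/
   (exists beta' : Z -> C, periodic L beta' /\ bilinear2 L M alpha beta' tau) ->
     v_equation L M alpha (v_of L M tau)).
Proof.
  rewrite <- v_equation_iff_bilinear1, <- v_equation_iff_bilinear2 by assumption.
  tauto.
Qed.
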